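(* Let $d=1$. For every $\alpha\in(0,1)$ there exist constants $C_1(\alpha),C_2(\alpha)\in(0,\infty)$ such that $$\sup_{f\in L(1,1/\alpha),\,f\ne0}\ \liminf_{p\to1+0}V_{\alpha,1}(f,p)\ge C_1(\alpha)$$ and $$\sup_{f\in L(1,1/\alpha),\,f\ne0}\ \liminf_{p\to1/\alpha-0}V_{\alpha,1}(f,p)\ge C_2(\alpha).$$
   Context: $|f|_p=\left(\int_{\mathbb R}|f(x)|^p\,dx\right)^{1/p}$; $L(a,b)=\bigcap_{p\in(a,b)}L_p(\mathbb R)$. The Riesz potential on $\mathbb R$ is $I_\alpha f(x)=\int_{\mathbb R}\frac{f(y)\,dy}{|x-y|^{1-\alpha}}$. For $p\in(1,1/\alpha)$ put $q=q(p)=p/(1-\alpha p)\in(1/(1-\alpha),\infty)$ and, for $f\neq0$, $$V_{\alpha,1}(f,p)=\frac{|I_\alpha f|_{q}\,\left[(p-1)(1/\alpha-p)\right]^{1-\alpha}}{|f|_p}.$$ *)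

(* Defs.v *)
From HB Require Import structures.
From mathcomp Require Import all_boot all_order all_algebra.
From mathcomp Require Import all_classical all_reals all_analysis.

Set Implicit Arguments.
Unset Strict Implicit.
Unset Printing Implicit Defensive.

Import Order.TTheory GRing.Theory Num.Theory.
Import numFieldNormedType.Exports.

Local Open Scope classical_set_scope.
Local Open Scope ring_scope.

(* L(a, b), the intersection of the spaces L_p(R) for p in ]a, b[; its elements
   are real-valued Borel functions, to be identified up to a.e. equality. *)
Definition Linter (R : realType) (a b : R) : set (R -> R) :=
  [set f | forall p : R, a < p < b ->
     f \in Lfun (@lebesgue_measure R) p%:E].

(* The value is only meaningful at the points x where the integral converges
   absolutely, hence it is extended-real valued. On the diagonal y = x the kernel
   evaluates to 0, by the convention 0^-1 = 0; this is a null set of y. *)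
Definition riesz_potential (R : realType) (alpha : R) (f : R -> R) (x : R) :
    \bar R :=
  (\int[@lebesgue_measure R]_y (f y / `|x - y| `^ (1 - alpha))%:E)%E.

Definition riesz_exponent (R : realType) (alpha p : R) : R :=
  p / (1 - alpha * p).

Definition riesz_V (R : realType) (alpha : R) (f : R -> R) (p : R) : \bar R :=
  ('N[@lebesgue_measure R]_((riesz_exponent alpha p)%:E)
      [riesz_potential alpha f]
    * (((p - 1) * (alpha^-1 - p)) `^ (1 - alpha))%:E
    / 'N[@lebesgue_measure R]_(p%:E) [EFin \o f])%E.

(* f <> 0 as an element of an L_p space: f does not vanish almost everywhere. *)
Definition ae_nonzero (R : realType) (f : R -> R) : Prop :=
  ~ f = cst 0 %[ae @lebesgue_measure R].

(* Main.v *)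
Require Import Defs.
From HB Require Import structures.
From mathcomp Require Import all_boot all_order all_algebra.
From mathcomp Require Import all_classical all_reals all_analysis.
From mathcomp Require Import measurable_realfun ring lra.

Import Order.TTheory GRing.Theory Num.Theory.
Import numFieldNormedType.Exports.

Local Open Scope classical_set_scope.
Local Open Scope ring_scope.

(* Near p = 1 take f to be the indicator of [0, 1]: then I_alpha f(x) >=
   x^(alpha - 1) for x >= 1, so |I_alpha f|_q^q >= (1 - alpha p) / (p - 1), and
   what remains is (p - 1)^(1 - 1/p) times factors bounded below.
   Near p = 1/alpha take f(x) = x^(- alpha) on ]0, 1], for which
   |f|_p^p = 1 / (1 - alpha p).  Since (y - x)^(alpha - 1) >= y^(alpha - 1), one
   has I_alpha f(x) >= - ln x on ]0, 1[, and restricting to ]0, exp (- q)[, where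
   - ln x >= q, gives |I_alpha f|_q >= q / e.  With u = 1 - alpha p, the
   powers of u combine into u^(u / p).
   In both cases t^s >= 1 / e for 0 < t <= 1 and s <= t concludes. *)

(** * Comparison tools: integrals, norms, lower limits, nonvanishing *)

(* [g] need not be measurable: the integral of a nonnegative function is a
   supremum over the simple functions below it. *)
Lemma le_integral_subset d (T : measurableType d) (R : realType)
    (mu : {measure set T -> \bar R}) (D : set T) (f g : T -> \bar R) :
  (forall x, D x -> 0 <= f x)%E -> (forall x, 0 <= g x)%E ->
  (forall x, D x -> f x <= g x)%E ->
  (\int[mu]_(x in D) f x <= \int[mu]_x g x)%E.
Proof.
move=> f0 g0 fg; rewrite integral_mkcond ge0_integralTE; last first.
  by move=> x; apply: erestrict_ge0.
rewrite ge0_integralTE//; apply: ereal_sup_le => _ [h hf <-].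
exists h => //= x; apply: le_trans (hf x) _; rewrite patchE.
by case: ifPn => [/set_mem /fg|].
Qed.

(** Meant for [F] a Riesz potential and [h] an explicit minorant on [D]: the norm is bounded below
    by monotonicity alone, without establishing that the potential is measurable. *)
Lemma Lnorm_ge_restrict d (T : measurableType d) (R : realType)
    (mu : {measure set T -> \bar R}) (D : set T) (F : T -> \bar R) (h : T -> R)
    (q : R) :
  0 < q -> (forall x, D x -> 0 <= h x) ->
  (forall x, D x -> (h x)%:E <= F x)%E ->
  ((\int[mu]_(x in D) (h x `^ q)%:E) `^ q^-1 <= 'N[mu]_(q%:E) [F])%E.
Proof.
move=> q0 h0 hF; rewrite unlock.
have int0 : (0 <= \int[mu]_(x in D) (h x `^ q)%:E)%E.
  by apply: integral_ge0 => x _; rewrite lee_fin powR_ge0.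
have le_int : (\int[mu]_(x in D) (h x `^ q)%:E <= \int[mu]_x `|F x| `^ q)%E.
  apply: le_integral_subset => [x _|x|x Dx].
  - by rewrite lee_fin powR_ge0.
  - exact: poweR_ge0.
  - rewrite -poweR_EFin; apply: gt0_ler_poweR; first exact: ltW.
    + by rewrite in_itv/= leey andbT lee_fin h0.
    + by rewrite in_itv/= leey andbT.
    + exact: le_trans (hF _ Dx) (lee_abs _).
apply: gt0_ler_poweR => //; rewrite ?invr_ge0 ?ltW//.
  by rewrite in_itv/= leey andbT.
by rewrite in_itv/= leey andbT (le_trans int0).
Qed.

(** The lower limit is the supremum, over members of [F], of the infimum of [f] there; the set where
    [c <= f] is itself such a member. *)
Lemma limf_einf_ge (T : choiceType) (X : filteredType T) (R : realType)
 (f : X -> \bar R) (F : set_system X) (c : \bar R) :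
  (\forall x \near F, c <= f x)%E -> (c <= limf_einf f F)%E.
Proof.
move=> cf; rewrite limf_einfE; apply: le_ereal_sup_tmp.
exists (ereal_inf (f @` [set x | c <= f x]%E)); first by exists [set x | c <= f x]%E.
by apply: le_ereal_inf_tmp => _ [x /= cfx <-].
Qed.

Lemma riesz_V_ge (R : realType) (alpha p L M : R) (f : R -> R) :
  0 <= L -> 0 < M ->
  (L%:E <= 'N[@lebesgue_measure R]_((riesz_exponent alpha p)%:E)
      [riesz_potential alpha f])%E ->
  ('N[@lebesgue_measure R]_(p%:E) [EFin \o f] <= M%:E)%E ->
  ((L * ((p - 1) * (alpha^-1 - p)) `^ (1 - alpha) / M)%:E <= riesz_V alpha f p)%E.
Proof.
move=> L0 M0 hL hM; rewrite /riesz_V EFinM EFinM.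
apply: lee_pmul.
- by rewrite -EFinM lee_fin mulr_ge0// powR_ge0.
- by rewrite lee_fin invr_ge0 ltW.
- by apply: lee_pmul; rewrite ?lee_fin ?powR_ge0.
- have -> : (M^-1%:E = M%:E^-1)%E by rewrite inver gt_eqF.
  by rewrite lee_pV2 // inE/= ?Lnorm_ge0// lee_fin ltW.
Qed.

(** Otherwise []a, b[], of measure [b - a > 0], would lie inside a null set. *)
Lemma neq0_ae_nonzero (R : realType) (f : R -> R) (a b : R) :
  a < b -> (forall x, a < x < b -> f x != 0) -> ae_nonzero f.
Proof.
move=> ab f0 [N [mN N0 fN]].
have : (lebesgue_measure `]a, b[%classic <= lebesgue_measure N)%E.
  apply: le_measure; rewrite ?inE// => x; rewrite /= in_itv/= => /f0/eqP fx.
  by apply: fN => /=; apply: contra_not fx; apply.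
rewrite N0 lebesgue_measure_itv/= lte_fin ab -EFinD lee_fin.
by rewrite leNgt subr_gt0 ab.
Qed.

(** * The bound for [t ^ s] and explicit integrals of powers *)

(** Since [t <= 1] and [s <= t], it suffices to bound [t ^ t]. There [ln v <= v - 1] at [v = 1 / t]
    gives [t * ln t >= t - 1 > -1]. *)
Lemma powR_self_ge (R : realType) (t s : R) :
  0 < t <= 1 -> s <= t -> expR (-1) <= t `^ s.
Proof.
move=> /andP[t0 t1] st; apply: (@le_trans _ _ (t `^ t)); last first.
  by apply: ger_powR; rewrite ?t0.
rewrite /powR gt_eqF// ler_expR.
have ti : -1 < t^-1 - 1 by rewrite ltrBDl subrr invr_gt0.
have := le_ln1Dx ti; rewrite addrC subrK lnV ?posrE// => h.
by rewrite -(ler_pM2l t0) mulrBr divff ?gt_eqF// in h; lra.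
Qed.

Lemma integral_powR_1y (R : realType) (s : R) : 1 < s ->
  (\int[lebesgue_measure]_(x in `[1%R, +oo[) (x `^ (- s))%:E = ((s - 1)^-1)%:E)%E.
Proof.
move=> s1; have s10 : 0 < s - 1 by rewrite subr_gt0.
have dpow (b x : R) : 0 < x -> derivable (@powR R ^~ b) x 1.
  by move=> x0; have h := is_derive1_powR b x0; exact: ex_derive.
pose F (x : R) := (- (s - 1)^-1) *: x `^ (1 - s).
have dF (x : R) : 0 < x -> derivable F x 1.
  by move=> x0; apply: derivableZ; exact: dpow.
rewrite (@ge0_continuous_FTC2y R _ F 1 0).
- by rewrite /F powR1 -EFinD add0r /GRing.scale/= mulr1 opprK.
- by move=> x _; exact: powR_ge0.
- apply: derivable_within_continuous => x; rewrite in_itv/= andbT => x1.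
  by apply: dpow; lra.
- rewrite [X in _ --> X](_ : 0 = (- (s - 1)^-1) *: (0 : R)); last by rewrite scaler0.
  apply: cvgZr; apply/cvgr0Pnorm_le => e e0.
  near=> x.
  have x0 : 0 < x by near: x; exact: nbhs_pinfty_gt.
  (* This threshold solves [x ^ (1 - s) = e]. *)
  have xe : e^-1 `^ (s - 1)^-1 <= x by near: x; exact: nbhs_pinfty_ge.
  rewrite ger0_norm ?powR_ge0// -opprB powRN -[e]invrK.
  rewrite lef_pV2 ?posrE ?invr_gt0 ?powR_gt0//.
  have := ge0_ler_powR (ltW s10) (powR_ge0 _ _) (ltW x0) xe.
  by rewrite -powRrM mulVf ?gt_eqF// powRr1// invr_ge0 ltW.
- by move=> x x1; apply: dF; lra.
- apply: cvg_at_right_filter; apply/differentiable_continuous/derivable1_diffP.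
  by apply: dF; lra.
- move=> x; rewrite in_itv/= andbT => x1.
  rewrite derive1E deriveZ; last by apply: dpow; lra.
  rewrite -derive1E powR_derive1; last by rewrite in_itv/= andbT; lra.
  have -> : 1 - s - 1 = - s by ring.
  by rewrite /GRing.scale/= mulrA -[1 - s]opprB mulrNN mulVf ?gt_eqF// mul1r.
Unshelve. all: by end_near. Qed.

Lemma integral_inv_01 (R : realType) (x : R) : 0 < x < 1 ->
  (\int[lebesgue_measure]_(y in `]x, 1%R]) (y^-1)%:E = (- ln x)%:E)%E.
Proof.
move=> /andP[x0 x1].
have dln y : x <= y -> derivable (@ln R) y 1.
  by move=> xy; apply: ex_derive; apply: is_derive1_ln; lra.
have cln y : x <= y -> {for y, continuous (@ln R)}.
  by move=> xy; apply: continuous_ln; lra.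
have cV : {within `[x, 1], continuous (fun y : R => y^-1)}.
  apply: derivable_within_continuous => y; rewrite in_itv/= => /andP[xy _].
  by apply: derivableV => //; rewrite gt_eqF//; lra.
rewrite integral_itv_obnd_cbnd; last first.
  apply/measurable_EFinP/measurable_fun_itv_bndo_bndcP.
  apply: subspace_continuous_measurable_fun => //.
  apply: continuous_subspaceW cV; exact: subset_itv_oo_cc.
rewrite (@continuous_FTC2 R _ (@ln R))//.
- by rewrite ln1 sub0e.
- split=> [y||].
  + by rewrite in_itv/= => /andP[xy _]; exact/dln/ltW.
  + by apply: cvg_at_right_filter; apply: cln.
  + by apply: cvg_at_left_filter; apply: cln; exact: ltW.
- move=> y; rewrite in_itv/= => /andP[xy _]; rewrite derive1E.
  have ? : is_derive y 1 (@ln R) y^-1 by apply: is_derive1_ln; lra.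
  exact: derive_val.
Qed.

(** The integrand may be singular at 0, so []0, 1]] is exhausted by compact intervals. On each of
    them the fundamental theorem of calculus gives [F 1] minus a nonnegative term, and the bound
    [F 1] survives the monotone limit. *)
Lemma integral_powR_01 (R : realType) (s : R) : s < 1 ->
  (\int[lebesgue_measure]_(x in `]0%R, 1%R]) (x `^ (- s))%:E <= ((1 - s)^-1)%:E)%E.
Proof.
move=> s1; have s10 : 0 < 1 - s by rewrite subr_gt0.
have dpow (b x : R) : 0 < x -> derivable (@powR R ^~ b) x 1.
  by move=> x0; have h := is_derive1_powR b x0; exact: ex_derive.
pose F (x : R) := (1 - s)^-1 *: x `^ (1 - s).
have dF (x : R) : 0 < x -> derivable F x 1.
  by move=> x0; apply: derivableZ; exact: dpow.
have cF (x : R) : 0 < x -> {for x, continuous F}.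
  by move=> x0; apply/differentiable_continuous/derivable1_diffP/dF.
(* Starting from [1 / 2] rather than 1 keeps every interval nondegenerate, as the fundamental
   theorem of calculus requires. *)
have -> : `]0, 1]%classic = \bigcup_i `[i.+2%:R^-1, 1 : R]%classic.
  apply/seteqP; split=> x /=.
    rewrite in_itv/= => /andP[x0 x1]; exists (Num.truncn x^-1) => //=.
    rewrite in_itv/= x1 andbT -[leRHS]invrK lef_pV2 ?posrE ?invr_gt0//.
    apply: (@le_trans _ _ (Num.truncn x^-1).+1%:R); last by rewrite ler_nat.
    by apply/ltW/truncnS_gt.
  move=> [i _ /=]; rewrite !in_itv/= => /andP[ix ->]; rewrite andbT.
  by apply: lt_le_trans ix; rewrite invr_gt0.
pose D i : set R := `[i.+2%:R^-1, 1]%classic.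
have ndD : nondecreasing_seq D.
  move=> m n mn; apply/subsetPset/subset_itvr; rewrite bnd_simp.
  by rewrite lef_pV2 ?posrE// ler_nat !ltnS.
have mD i : measurable (D i) by exact: measurable_itv.
have mf i : measurable_fun (D i) (fun x : R => (x `^ (- s))%:E).
  by apply/measurable_EFinP; apply: measurable_funTS; exact: measurable_powR.
have f0 i x : D i x -> (0 <= (x `^ (- s))%:E)%E by rewrite lee_fin powR_ge0.
apply: (cvge_to_le (ge0_nondecreasing_set_cvg_integral (mu := lebesgue_measure)
  ndD mD mf f0)).
apply: nearW => i.
have i0 : 0 < i.+2%:R^-1 :> R by rewrite invr_gt0.
rewrite (@continuous_FTC2 R _ F).
- rewrite /F powR1 -EFinD lee_fin /GRing.scale/= mulr1 lerBlDr lerDl.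
  by rewrite mulr_ge0 ?powR_ge0// invr_ge0 ltW.
- by rewrite invf_lt1// ltr1n.
- apply: derivable_within_continuous => x; rewrite in_itv/= => /andP[ix _].
  by apply: dpow; exact: lt_le_trans ix.
- split=> [y||].
  + by rewrite in_itv/= => /andP[iy _]; apply: dF; exact: lt_trans iy.
  + by apply: cvg_at_right_filter; apply: cF.
  + by apply: cvg_at_left_filter; apply: cF.
- move=> x; rewrite in_itv/= => /andP[ix _]; have x0 := lt_trans i0 ix.
  rewrite derive1E deriveZ; last by exact: dpow.
  rewrite -derive1E powR_derive1; last by rewrite in_itv/= andbT.
  have -> : 1 - s - 1 = - s by ring.
  by rewrite /GRing.scale/= mulrA mulVf ?gt_eqF// mul1r.
Qed.

(** * The two test functions: norms and pointwise bounds on their potentials *)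

Lemma mem_Lfun_le (R : realType) (p M : R) (f : R -> R) :
  measurable_fun setT f ->
  ('N[@lebesgue_measure R]_(p%:E) [EFin \o f] <= M%:E)%E ->
  f \in Lfun (@lebesgue_measure R) p%:E.
Proof.
move=> mf fM; rewrite inE; apply/andP; split; rewrite inE//=.
exact: le_lt_trans fM (ltry _).
Qed.

Lemma Lnorm_indic_unit (R : realType) (p : R) : 0 < p ->
  ('N[@lebesgue_measure R]_(p%:E) [EFin \o \1_(`[0%R, 1%R]%classic : set R)] =
    1)%E.
Proof.
move=> p0; rewrite unlock.
have -> : (\int[@lebesgue_measure R]_x
      `|(EFin \o \1_(`[0%R, 1%R]%classic : set R)) x| `^ p =
    \int[@lebesgue_measure R]_x (\1_(`[0%R, 1%R]%classic : set R) x)%:E)%E.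
  apply: eq_integral => x _ /=.
  rewrite indicE normr_nat; case: (_ \in _); first by rewrite powR1.
  by rewrite powR0// gt_eqF.
rewrite integral_indic//= setIT lebesgue_measure_itv/= lte_fin ltr01.
by rewrite -EFinD subr0 poweR1r.
Qed.

Lemma riesz_potential_indic_ge (R : realType) (alpha x : R) :
  alpha < 1 -> 1 <= x ->
  ((x `^ (alpha - 1))%:E <=
    riesz_potential alpha (\1_(`[0%R, 1%R]%classic : set R)) x)%E.
Proof.
move=> a1 x1; have x0 : 0 < x by lra.
(* The right endpoint is left out so that [x - y > 0] even for [x = 1]; on the diagonal the kernel
   is 0 by convention and the minorization would fail. *)
have -> : ((x `^ (alpha - 1))%:E =
    \int[@lebesgue_measure R]_(y in `[0%R, 1%R[) (x `^ (alpha - 1))%:E)%E.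
  rewrite integral_cst//= lebesgue_measure_itv/= lte_fin ltr01.
  by rewrite -EFinD subr0 mule1.
apply: le_integral_subset => [y _|y|y /=].
- by rewrite lee_fin powR_ge0.
- by rewrite lee_fin divr_ge0 ?powR_ge0// indicE.
rewrite in_itv/= => /andP[y0 y1]; rewrite lee_fin indicE mem_set/=; last first.
  by rewrite in_itv/= y0 ltW.
have -> : `|x - y| = x - y by rewrite ger0_norm; lra.
have xy : 0 < x - y by lra.
rewrite mul1r -opprB powRN lef_pV2 ?posrE ?powR_gt0//.
by apply: ge0_ler_powR; rewrite ?nnegrE; lra.
Qed.

(** The exponent is critical: the [p]-th power is integrable at 0 exactly when [p < 1 / alpha]. *)
Definition truncated_power (R : realType) (alpha x : R) : R :=
  \1_(`]0, 1]%classic : set R) x * x `^ (- alpha).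

Lemma truncated_power_ge0 (R : realType) (alpha x : R) :
  0 <= truncated_power R alpha x.
Proof. by rewrite mulr_ge0 ?powR_ge0// indicE. Qed.

Lemma truncated_powerE (R : realType) (alpha x : R) : 0 < x <= 1 ->
  truncated_power R alpha x = x `^ (- alpha).
Proof. by move=> x01; rewrite /truncated_power indicE mem_set ?mul1r//= in_itv. Qed.

Lemma measurable_truncated_power (R : realType) (alpha : R) :
  measurable_fun setT (truncated_power R alpha).
Proof. by apply: measurable_funM => //; exact: measurable_powR. Qed.

Lemma Lnorm_truncated_power_le (R : realType) (alpha p : R) :
  0 < p -> alpha * p < 1 ->
  ('N[@lebesgue_measure R]_(p%:E) [EFin \o truncated_power R alpha] <=
    ((1 - alpha * p)^-1 `^ p^-1)%:E)%E.
Proof.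
move=> p0 ap1; rewrite unlock -poweR_EFin.
have fE : (\int[@lebesgue_measure R]_x
      `|(EFin \o truncated_power R alpha) x| `^ p =
    \int[@lebesgue_measure R]_(x in `]0%R, 1%R]) (x `^ (- (alpha * p)))%:E)%E.
  rewrite [RHS]integral_mkcond; apply: eq_integral => x _ /=.
  rewrite ger0_norm ?truncated_power_ge0// patchE /truncated_power indicE.
  case: ifPn => xI; last by rewrite mul0r powR0// gt_eqF.
  by rewrite mul1r -powRrM mulNr.
rewrite fE; apply: gt0_ler_poweR; rewrite ?invr_ge0 ?(ltW p0)//.
- rewrite in_itv/= leey andbT; apply: integral_ge0 => x _.
  by rewrite lee_fin powR_ge0.
- by rewrite in_itv/= leey andbT lee_fin invr_ge0; lra.
- exact: integral_powR_01.
Qed.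

(** Only [y] in []x, 1]] is kept. There [0 < y - x < y], so the integrand is at least
    [y ^ (- alpha) * y ^ (alpha - 1) = 1 / y]. *)
Lemma riesz_potential_truncated_power_ge (R : realType) (alpha x : R) :
  0 < alpha < 1 -> 0 < x < 1 ->
  ((- ln x)%:E <= riesz_potential alpha (truncated_power R alpha) x)%E.
Proof.
move=> /andP[a0 a1] /andP[x0 x1]; rewrite -integral_inv_01; last by rewrite x0.
apply: le_integral_subset => [y /=|y|y /=].
- by rewrite in_itv/= lee_fin invr_ge0 => /andP[xy _]; lra.
- by rewrite lee_fin divr_ge0 ?powR_ge0// truncated_power_ge0.
rewrite in_itv/= lee_fin => /andP[xy y1]; have y0 := lt_trans x0 xy.
rewrite truncated_powerE ?y0// ltr0_norm ?subr_lt0// opprB.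
have -> : y^-1 = y `^ (- alpha) * (y `^ (1 - alpha))^-1.
  rewrite -powRN -powRD; last by rewrite (gt_eqF y0) implybT.
  have -> : - alpha - (1 - alpha) = -1 by ring.
  by rewrite powR_inv1// ltW.
rewrite ler_pM2l ?powR_gt0// lef_pV2 ?posrE ?powR_gt0 ?subr_gt0//.
by apply: ge0_ler_powR; rewrite ?nnegrE; lra.
Qed.

(** * Lower bounds for the norms of the potentials *)

Lemma Lnorm_riesz_potential_indic_ge (R : realType) (alpha p : R) :
  0 < alpha < 1 -> 1 < p < alpha^-1 ->
  ((((1 - alpha * p) / (p - 1)) `^ (p^-1 - alpha))%:E <=
    'N[@lebesgue_measure R]_((riesz_exponent alpha p)%:E)
      [riesz_potential alpha (\1_(`[0%R, 1%R]%classic : set R))])%E.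
Proof.
move=> /andP[a0 a1] /andP[p1 pa].
have u0 : 0 < 1 - alpha * p by rewrite subr_gt0 -ltr_pdivlMl// mulr1.
have p0 : 0 < p by lra.
have q0 : 0 < riesz_exponent alpha p by rewrite divr_gt0.
have -> : p^-1 - alpha = (riesz_exponent alpha p)^-1.
  by rewrite invf_div mulrBl mul1r mulfK ?gt_eqF.
set q := riesz_exponent alpha p in q0 *.
(* The [q]-th power of the minorant is [x ^ (- s)] with [s = (1 - alpha) * q]. Its integral over
   [[1, +oo[] is [1 / (s - 1)], finite because [p > 1] makes this quantity positive. *)
have qE : (1 - alpha) * q - 1 = (p - 1) / (1 - alpha * p).
  by rewrite /q /riesz_exponent; field; rewrite gt_eqF.
have q1 : 1 < (1 - alpha) * q.
  by rewrite -subr_gt0 qE divr_gt0// subr_gt0.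
have h0 (x : R) : `[1, +oo[%classic x -> 0 <= x `^ (alpha - 1).
  by rewrite powR_ge0.
have hF (x : R) : `[1, +oo[%classic x -> ((x `^ (alpha - 1))%:E <=
    riesz_potential alpha (\1_(`[0%R, 1%R]%classic : set R)) x)%E.
  by rewrite /= in_itv/= andbT; exact: riesz_potential_indic_ge.
apply: le_trans (Lnorm_ge_restrict _ _ R lebesgue_measure _ _ _ _ q0 h0 hF).
under eq_integral => x _ do rewrite -powRrM -opprB mulNr.
by rewrite integral_powR_1y// qE !invf_div poweR_EFin.
Qed.

(** Cutting at [- ln x > c] leaves an interval of length [exp (- c)] and the bound
    [c * exp (- c / q)], which is largest at [c = q]. *)
Lemma Lnorm_riesz_potential_truncated_power_ge (R : realType) (alpha q : R) :
  0 < alpha < 1 -> 0 < q ->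
  ((q * expR (-1))%:E <= 'N[@lebesgue_measure R]_(q%:E)
      [riesz_potential alpha (truncated_power R alpha)])%E.
Proof.
move=> a01 q0.
have h0 (x : R) : `]0, expR (- q)[%classic x -> 0 <= q by rewrite ltW.
have hF (x : R) : `]0, expR (- q)[%classic x -> (q%:E <=
    riesz_potential alpha (truncated_power R alpha) x)%E.
  rewrite /= in_itv/= => /andP[x0 xq].
  have x1 : x < 1 by apply: lt_trans xq _; rewrite expR_lt1 oppr_lt0.
  apply: (@le_trans _ _ (- ln x)%:E); last first.
    by apply: riesz_potential_truncated_power_ge; rewrite ?x0.
  rewrite lee_fin lerNr -[leRHS]expRK.
  by rewrite ler_ln ?posrE ?expR_gt0// ltW.
apply: le_trans (Lnorm_ge_restrict _ _ R lebesgue_measure _ _ _ _ q0 h0 hF).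
rewrite integral_cst//= lebesgue_measure_itv/= lte_fin expR_gt0 -EFinD subr0.
rewrite -EFinM poweR_EFin lee_fin powRM ?powR_ge0 ?expR_ge0//.
rewrite -powRrM mulfV ?gt_eqF// powRr1 ?(ltW q0)//.
by rewrite /powR gt_eqF ?expR_gt0// expRK mulrN mulVf// gt_eqF.
Qed.

(** * Membership of the test functions in [Linter] *)

Lemma indic_Linter (R : realType) (a b : R) : 0 <= a ->
  Linter a b (\1_(`[0%R, 1%R]%classic : set R)).
Proof.
move=> a0 p /andP[ap _]; apply: (mem_Lfun_le _ _ 1) => //.
by rewrite Lnorm_indic_unit// (le_lt_trans a0).
Qed.

Lemma truncated_power_Linter (R : realType) (alpha a : R) :
  0 < alpha -> 0 <= a -> Linter a alpha^-1 (truncated_power R alpha).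
Proof.
move=> alpha0 a0 p /andP[ap pb].
apply: (mem_Lfun_le _ _ ((1 - alpha * p)^-1 `^ p^-1)).
  exact: measurable_truncated_power.
apply: Lnorm_truncated_power_le; first exact: le_lt_trans ap.
by rewrite -ltr_pdivlMl// mulr1.
Qed.

(** * Uniform lower bounds for [riesz_V] near each endpoint, and conclusion *)

(** Staying below the midpoint of 1 and [1 / alpha] keeps [1 - alpha * p] and [1 / alpha - p] away
    from 0, which yields the first and last factors of the constant. The factor [1 / e] bounds what
    remains of the powers of [p - 1], a base at most 1 because [p <= 2]. *)
Lemma riesz_V_indic_ge (R : realType) (alpha p : R) :
  0 < alpha < 1 -> 1 < p <= 2 -> p <= (1 + alpha^-1) / 2 ->
  (((1 - alpha) / 2 * expR (-1) * ((alpha^-1 - 1) / 2) `^ (1 - alpha))%:E <=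
    riesz_V alpha (\1_(`[0%R, 1%R]%classic : set R)) p)%E.
Proof.
move=> /[dup] a01 /andP[a0 a1] /andP[p1 p2] pm.
have va1 : 1 < alpha^-1 by rewrite invf_gt1.
have pa : p < alpha^-1 by lra.
have u_ge : (1 - alpha) / 2 <= 1 - alpha * p.
  have : alpha * p <= alpha * ((1 + alpha^-1) / 2) by rewrite ler_pM2l.
  by rewrite mulrA mulrDr mulr1 mulfV ?gt_eqF//; lra.
have u0 : 0 < 1 - alpha * p by lra.
have u1 : 1 - alpha * p <= 1 by rewrite gerBl mulr_ge0//; lra.
have p0 : 0 < p by lra.
have pV1 : p^-1 <= 1 by rewrite invf_le1//; lra.
have e0 : 0 <= p^-1 - alpha.
  by rewrite subr_ge0 -[leLHS]invrK lef_pV2 ?posrE ?invr_gt0// ltW.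
have pa' : 1 < p < alpha^-1 by rewrite p1.
have N1 : ('N[@lebesgue_measure R]_(p%:E)
    [EFin \o (\1_(`[0%R, 1%R]%classic : set R))] <= 1%:E)%E.
  by rewrite Lnorm_indic_unit.
apply: le_trans (riesz_V_ge _ _ _ _ _ _ (powR_ge0 _ _) ltr01
  (Lnorm_riesz_potential_indic_ge _ _ _ a01 pa') N1).
rewrite lee_fin invr1 mulr1.
have t0 : 0 < p - 1 by lra.
rewrite [(_ / (p - 1)) `^ _]powRM ?invr_ge0 ?(ltW u0) ?(ltW t0)//
  [((p - 1) * _) `^ _]powRM; [|lra..].
set A := _ `^ (p^-1 - alpha).
set B := (alpha^-1 - p) `^ (1 - alpha).
(* The exponents of [p - 1] add up: [- (1 / p - alpha) + (1 - alpha) = 1 - 1 / p]. *)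
have -> : A * (p - 1)^-1 `^ (p^-1 - alpha) * ((p - 1) `^ (1 - alpha) * B) =
    A * (p - 1) `^ (1 - p^-1) * B.
  rewrite !mulrA -[_ * _ * (p - 1) `^ _]mulrA; congr (_ * _ * _).
  rewrite -powR_inv1; last by lra.
  rewrite -powRrM -powRD; last by rewrite (gt_eqF t0) implybT.
  congr (_ `^ _); ring.
apply: ler_pM; rewrite ?mulr_ge0 ?powR_ge0 ?expR_ge0//; first by lra.
- apply: ler_pM; rewrite ?expR_ge0//; first by lra.
  (* A base in []0, 1]] raised to an exponent at most 1 is at least the base. *)
  + apply: le_trans u_ge _; apply: ger1_powR; first by rewrite u0.
    lra.
  + apply: powR_self_ge; first lra.
    have -> : 1 - p^-1 = (p - 1) / p by rewrite mulrBl mulfV ?gt_eqF// mul1r.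
    by rewrite ler_piMr//; lra.
- by apply: ge0_ler_powR; rewrite ?nnegrE; lra.
Qed.

(** One factor [1 / e] comes from the norm of the potential, the other from the collected powers of
    [u = 1 - alpha * p]. Staying above the midpoint bounds [p - 1] from below. *)
Lemma riesz_V_truncated_power_ge (R : realType) (alpha p : R) :
  0 < alpha < 1 -> (1 + alpha^-1) / 2 <= p < alpha^-1 ->
  ((expR (-1) * expR (-1) * ((alpha^-1 - 1) / 2) `^ (1 - alpha))%:E <=
    riesz_V alpha (truncated_power R alpha) p)%E.
Proof.
move=> /[dup] a01 /andP[a0 a1] /andP[pm pa].
have va1 : 1 < alpha^-1 by rewrite invf_gt1.
have p1 : 1 < p by lra.
have p0 : 0 < p by lra.
have uE : 1 - alpha * p = alpha * (alpha^-1 - p).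
  by rewrite mulrBr mulfV// gt_eqF.
have u0 : 0 < 1 - alpha * p by rewrite uE mulr_gt0// subr_gt0.
have u1 : 1 - alpha * p <= 1 by rewrite gerBl mulr_ge0//; lra.
have ap1 : alpha * p < 1 by lra.
have q0 : 0 < riesz_exponent alpha p by rewrite divr_gt0.
have M0 : 0 < (1 - alpha * p)^-1 `^ p^-1 by rewrite powR_gt0// invr_gt0.
have L0 : 0 <= riesz_exponent alpha p * expR (-1).
  by rewrite mulr_ge0 ?expR_ge0// ltW.
apply: le_trans (riesz_V_ge _ _ _ _ _ _ L0 M0
  (Lnorm_riesz_potential_truncated_power_ge _ _ _ a01 q0)
  (Lnorm_truncated_power_le _ _ _ p0 ap1)).
rewrite lee_fin powRM; [|lra..].
set u := 1 - alpha * p in uE u0 u1 *.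
have -> : (u^-1 `^ p^-1)^-1 = u `^ p^-1.
  by rewrite -powRN -[u^-1]powR_inv1 ?(ltW u0)// -powRrM mulrNN mul1r.
have qu : u^-1 <= riesz_exponent alpha p.
  by rewrite /riesz_exponent -/u ler_peMl ?invr_ge0; lra.
(* Here [u = alpha * (1 / alpha - p)] and [alpha < 1]. *)
have wu : u `^ (1 - alpha) <= (alpha^-1 - p) `^ (1 - alpha).
  apply: ge0_ler_powR; rewrite ?nnegrE; try lra.
  by rewrite uE ler_piMl; lra.
(* The three powers come from [q >= 1 / u], from the weight in [riesz_V], and from dividing by the
   norm of the test function. Their exponents sum to [u / p <= u], as [powR_self_ge] requires. *)
have cu : expR (-1) <= u^-1 * u `^ (1 - alpha) * u `^ p^-1.
  rewrite -[u^-1]powR_inv1 ?(ltW u0)// -!powRD; try by rewrite (gt_eqF u0) implybT.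
  apply: powR_self_ge; first by rewrite u0.
  have -> : -1 + (1 - alpha) + p^-1 = u / p.
    by rewrite /u mulrBl mulfK ?gt_eqF// mul1r; ring.
  by rewrite ler_piMr ?(ltW u0)// invf_le1//; lra.
have kp : ((alpha^-1 - 1) / 2) `^ (1 - alpha) <= (p - 1) `^ (1 - alpha).
  by apply: ge0_ler_powR; rewrite ?nnegrE; lra.
apply: (@le_trans _ _ (u^-1 * u `^ (1 - alpha) * u `^ p^-1 * expR (-1) *
    (p - 1) `^ (1 - alpha))).
  apply: ler_pM => //; rewrite ?mulr_ge0 ?expR_ge0 ?powR_ge0//.
  by rewrite ler_pM2r ?expR_gt0.
have -> : u^-1 * u `^ (1 - alpha) * u `^ p^-1 * expR (-1) * (p - 1) `^ (1 - alpha)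
  = u^-1 * expR (-1) * ((p - 1) `^ (1 - alpha) * u `^ (1 - alpha)) * u `^ p^-1.
  by ring.
rewrite ler_pM2r ?powR_gt0//; apply: ler_pM.
- by rewrite mulr_ge0 ?expR_ge0 ?invr_ge0// ltW.
- by rewrite mulr_ge0 ?powR_ge0.
- by rewrite ler_pM2r ?expR_gt0.
- by rewrite ler_pM2l// powR_gt0//; lra.
Qed.

Theorem theorem3 (R : realType) (alpha : R) (halpha : 0 < alpha < 1) :
  exists C1 C2 : R,
    [/\ 0 < C1, 0 < C2,
      (C1%:E <= ereal_sup [set limf_einf (riesz_V alpha f) 1^'+
                          | f in Linter 1 alpha^-1 `&` @ae_nonzero R])%E
    & (C2%:E <= ereal_sup [set limf_einf (riesz_V alpha f) (alpha^-1)^'-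
                          | f in Linter 1 alpha^-1 `&` @ae_nonzero R])%E].
Proof.
have /andP[a0 a1] := halpha.
have va1 : 1 < alpha^-1 by rewrite invf_gt1.
have k0 : 0 < ((alpha^-1 - 1) / 2) `^ (1 - alpha) by rewrite powR_gt0//; lra.
exists ((1 - alpha) / 2 * expR (-1) * ((alpha^-1 - 1) / 2) `^ (1 - alpha)).
exists (expR (-1) * expR (-1) * ((alpha^-1 - 1) / 2) `^ (1 - alpha)).
split.
- by rewrite !mulr_gt0 ?expR_gt0//; lra.
- by rewrite !mulr_gt0 ?expR_gt0.
- apply: le_ereal_sup_tmp.
  exists (limf_einf (riesz_V alpha (\1_(`[0%R, 1%R]%classic : set R))) 1^'+).
    exists (\1_(`[0%R, 1%R]%classic : set R)) => //; split.
      exact: indic_Linter.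
    apply: (neq0_ae_nonzero _ _ 0 1) => // x /andP[x0 x1].
    by rewrite indicE mem_set ?oner_neq0//= in_itv/= !ltW.
  (* Since [1 / alpha > 1], both 2 and the midpoint exceed 1, so [p] close to 1 from the right stays
     below them. *)
  apply: limf_einf_ge; near=> p; apply: riesz_V_indic_ge => //.
  + apply/andP; split; near: p; first exact: nbhs_right_gt.
    by apply: nbhs_right_le; lra.
  + by near: p; apply: nbhs_right_le; lra.
- apply: le_ereal_sup_tmp.
  exists (limf_einf (riesz_V alpha (truncated_power R alpha)) (alpha^-1)^'-).
    exists (truncated_power R alpha) => //; split.
      exact: truncated_power_Linter.
    apply: (neq0_ae_nonzero _ _ 0 1) => // x /andP[x0 x1].
    by rewrite truncated_powerE ?x0 ?ltW// gt_eqF// powR_gt0.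
  apply: limf_einf_ge; near=> p; apply: riesz_V_truncated_power_ge => //.
  apply/andP; split; near: p; last exact: nbhs_left_lt.
  by apply: nbhs_left_ge; lra.
Unshelve. all: by end_near. Qed.
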